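(* Let $A$ and $X$ be (disjoint) sets and let $R \subseteq A \times X$ be a relation. Let $D_A$, $D_X$ be the Dowker complexes of $R$, let $P_A$, $P_X$ be their face posets, and let $\tilde{R} \subseteq P_A \times P_X$ be the relation induced by $R$, i.e. $\sigma_A \tilde{R} \sigma_X$ if and only if $aRx$ for all $a \in \sigma_A$ and $x \in \sigma_X$. Let $D_A \star_{\tilde{R}} D_X$ be the relational join complex. Then $$\|D_A\| \simeq \|D_A \star_{\tilde{R}} D_X\| \simeq \|D_X\|,$$ where $\simeq$ denotes homotopy equivalence.
   Context: For a relation $R \subseteq A \times X$, write $aRx$ for $(a,x)\in R$. The Dowker complex $D_A$ is the abstract simplicial complex whose simplices are the non-empty finite subsets $\sigma_A \subseteq A$ such that $\sigma_A \times \{x\} \subseteq R$ for some $x \in X$; symmetrically, the simplices of $D_X$ are the non-empty finite subsets $\sigma_X \subseteq X$ such that $\{a\} \times \sigma_X \subseteq R$ for some $a \in A$. The face poset of a simplicial complex is the set of its (non-empty) simplices ordered by inclusion. For simplicial complexes $K, M$ with disjoint vertex sets and a relation $\tilde{R} \subseteq P_K \times P_M$ between their face posets (a subset that is downward closed in the product order), the relational join complex is the abstract simplicial complex $$K \star_{\tilde{R}} M = K \cup M \cup \{\sigma_K \cup \sigma_M \mid \sigma_K \tilde{R} \sigma_M\}.$$ $\|K\|$ denotes the geometric realization of a simplicial complex $K$. *)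

(* Defs.v *)
From HB Require Import structures.
From mathcomp Require Import all_boot all_order all_algebra finmap.
From mathcomp Require Import all_classical all_reals all_analysis.

Set Implicit Arguments.
Unset Strict Implicit.
Unset Printing Implicit Defensive.

Import Order.TTheory GRing.Theory Num.Theory.
Import numFieldNormedType.Exports.

Local Open Scope fset_scope.
Local Open Scope classical_set_scope.
Local Open Scope ring_scope.

(* The vertices of [K] are the [v] with [faces K [fset v]]; a point of [V]
   need not be a vertex. *)
Record simplicial_complex (V : choiceType) := SimplicialComplex {
  faces : set {fset V};
  faces_neq0 : forall s, faces s -> s != fset0;
  faces_down : forall s t, faces s -> (t `<=` s)%fset -> t != fset0 -> faces t
}.

Definition face_poset (V : choiceType) (K : simplicial_complex V) : Type :=
  set_type (faces K).

Section FacePoset.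
Context (V : choiceType) (K : simplicial_complex V).
Implicit Types s t : face_poset K.

HB.instance Definition _ := Choice.on (face_poset K).

Definition face_le s t : bool := (val s `<=` val t)%fset.

Fact face_le_refl : reflexive face_le.
Proof. by move=> s; exact: fsubset_refl. Qed.

Fact face_le_anti : antisymmetric face_le.
Proof. by move=> s t; rewrite /face_le -eqEfsubset => /eqP/val_inj. Qed.

Fact face_le_trans : transitive face_le.
Proof. by move=> t s u; exact: fsubset_trans. Qed.

Fact face_display : Order.disp_t. Proof. exact: Order.default_display. Qed.

HB.instance Definition _ := Order.Le_isPOrder.Build face_display (face_poset K)
  face_le_refl face_le_anti face_le_trans.

End FacePoset.

Record poset_relation d (P : porderType d) d' (Q : porderType d') :=
  PosetRelation {
    poset_rel :> P -> Q -> Prop;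
    poset_rel_down : forall p p' q q',
      (p' <= p)%O -> (q' <= q)%O -> poset_rel p q -> poset_rel p' q'
  }.

Section RelationalJoin.
Context (V W : choiceType).

(* The vertex sets are made disjoint by placing both in [V + W]. *)
Definition inlf (s : {fset V}) : {fset V + W} := (inl @` s)%fset.
Definition inrf (t : {fset W}) : {fset V + W} := (inr @` t)%fset.

Lemma inl_inlf s x : (inl x \in inlf s) = (x \in s).
Proof. by rewrite mem_imfset//=; exact: inl_inj. Qed.

Lemma inr_inrf t y : (inr y \in inrf t) = (y \in t).
Proof. by rewrite mem_imfset//=; exact: inr_inj. Qed.

Lemma inr_inlf s y : (inr y \in inlf s) = false.
Proof. by apply/negP => /imfsetP[]. Qed.

Lemma inl_inrf t x : (inl x \in inrf t) = false.
Proof. by apply/negP => /imfsetP[]. Qed.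

Definition inf_simpl :=
  (in_fsetU, inl_inlf, inr_inrf, inr_inlf, inl_inrf, in_fset0, orbF).

Lemma inf_split (u : {fset V + W}) :
  exists (s : {fset V}) (t : {fset W}), u = (inlf s `|` inrf t)%fset.
Proof.
pose getl (z : V + W) := if z is inl x then Some x else None.
pose getr (z : V + W) := if z is inr y then Some y else None.
exists [fset x in pmap getl u]%fset, [fset y in pmap getr u]%fset.
apply/fsetP => -[x|y]; rewrite !inf_simpl/= !inE /= mem_pmap;
  apply/idP/mapP.
- by move=> zu; exists (inl x).
- by move=> [[z|z] zu //= [->]].
- by move=> zu; exists (inr y).
- by move=> [[z|z] zu //= [->]].
Qed.

Context (K : simplicial_complex V) (M : simplicial_complex W).
Context (Rt : poset_relation (face_poset K) (face_poset M)).

Definition join_faces : set {fset V + W} :=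
  (inlf @` faces K) `|` (inrf @` faces M) `|`
  [set u | exists (s : face_poset K) (t : face_poset M),
     Rt s t /\ u = (inlf (val s) `|` inrf (val t))%fset].

Fact join_faces_neq0 s : join_faces s -> s != fset0.
Proof.
have inl0 a : faces K a -> inlf a != fset0.
  move=> /faces_neq0 /fset0Pn[x xa]; apply/fset0Pn; exists (inl x).
  exact: in_imfset.
have inr0 b : faces M b -> inrf b != fset0.
  move=> /faces_neq0 /fset0Pn[x xb]; apply/fset0Pn; exists (inr x).
  exact: in_imfset.
case=> [[[a Ka <-]|[b Mb <-]]|[a [b [_ ->]]]]; [exact: inl0|exact: inr0|].
have /inl0/fset0Pn[x xa] := set_mem (valP a).
by apply/fset0Pn; exists x; rewrite in_fsetU xa.
Qed.

Fact join_faces_down s t :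
  join_faces s -> (t `<=` s)%fset -> t != fset0 -> join_faces t.
Proof.
have [a [b ->]] := inf_split t => Js /fsubsetP ts ab0.
have inlfU0 : (inlf a `|` inrf fset0 = inlf a)%fset.
  by apply/fsetP => -[x|y]; rewrite !inf_simpl.
have inrf0U : (inlf fset0 `|` inrf b = inrf b)%fset.
  by apply/fsetP => -[x|y]; rewrite !inf_simpl.
have asub x : x \in a -> inl x \in s by move=> xa; apply: ts; rewrite !inf_simpl.
have bsub y : y \in b -> inr y \in s by move=> yb; apply: ts; rewrite !inf_simpl.
have Ka : a != fset0 -> faces K a.
  move=> a0; case: Js asub => [[[c Kc <-]|[c Mc <-]]|[c [d [_ ->]]]] asub.
  - apply: (faces_down Kc) => //; apply/fsubsetP => x /asub.
    by rewrite inf_simpl.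
  - by have /fset0Pn[x /asub] := a0; rewrite inf_simpl.
  - apply: (faces_down (set_mem (valP c))) => //; apply/fsubsetP => x /asub.
    by rewrite !inf_simpl.
have Mb : b != fset0 -> faces M b.
  move=> b0; case: Js bsub => [[[c Kc <-]|[c Mc <-]]|[c [d [_ ->]]]] bsub.
  - by have /fset0Pn[x /bsub] := b0; rewrite inf_simpl.
  - apply: (faces_down Mc) => //; apply/fsubsetP => x /bsub.
    by rewrite inf_simpl.
  - apply: (faces_down (set_mem (valP d))) => //; apply/fsubsetP => x /bsub.
    by rewrite !inf_simpl.
have [a0|a0] := eqVneq a fset0.
  have [b0|b0] := eqVneq b fset0.
    by move: ab0; rewrite a0 b0 => /fset0Pn[[x|y]]; rewrite !inf_simpl.
  by left; right; apply: (ex_intro2 _ _ b (Mb b0)); rewrite a0 inrf0U.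
have [b0|b0] := eqVneq b fset0.
  by left; left; apply: (ex_intro2 _ _ a (Ka a0)); rewrite b0 inlfU0.
right; exists (SigSub (mem_set (Ka a0))), (SigSub (mem_set (Mb b0))).
split=> //; case: Js asub bsub => [[[c Kc <-]|[c Mc <-]]|[c [d [cd ->]]]] asub bsub.
- by have /fset0Pn[x /bsub] := b0; rewrite inf_simpl.
- by have /fset0Pn[x /asub] := a0; rewrite inf_simpl.
- apply: poset_rel_down cd; apply/fsubsetP => z.
    by move=> /asub; rewrite !inf_simpl.
  by move=> /bsub; rewrite !inf_simpl.
Qed.

Definition relational_join : simplicial_complex (V + W)%type :=
  SimplicialComplex join_faces_neq0 join_faces_down.

End RelationalJoin.

Section Dowker.
Context (A X : choiceType) (Rel : set (A * X)).

Definition dowker_faces_l : set {fset A} :=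
  [set s | s != fset0 /\ exists x, [set` s] `*` [set x] `<=` Rel].

Definition dowker_faces_r : set {fset X} :=
  [set t | t != fset0 /\ exists a, [set a] `*` [set` t] `<=` Rel].

Fact dowker_faces_l_neq0 s : dowker_faces_l s -> s != fset0.
Proof. by case. Qed.

Fact dowker_faces_r_neq0 t : dowker_faces_r t -> t != fset0.
Proof. by case. Qed.

Fact dowker_faces_l_down s t :
  dowker_faces_l s -> (t `<=` s)%fset -> t != fset0 -> dowker_faces_l t.
Proof.
move=> [_ [x sx]] /fsubsetP ts t0; split=> //; exists x => -[a y] [/= /ts as_ yx].
exact: sx.
Qed.

Fact dowker_faces_r_down s t :
  dowker_faces_r s -> (t `<=` s)%fset -> t != fset0 -> dowker_faces_r t.
Proof.
move=> [_ [a sa]] /fsubsetP ts t0; split=> //; exists a => -[b y] [/= ba /ts ys].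
exact: sa.
Qed.

Definition dowker_l : simplicial_complex A :=
  SimplicialComplex dowker_faces_l_neq0 dowker_faces_l_down.

Definition dowker_r : simplicial_complex X :=
  SimplicialComplex dowker_faces_r_neq0 dowker_faces_r_down.

Definition induced_rel (s : face_poset dowker_l) (t : face_poset dowker_r) :=
  forall a x, a \in val s -> x \in val t -> Rel (a, x).

Fact induced_rel_down s s' t t' :
  (s' <= s)%O -> (t' <= t)%O -> induced_rel s t -> induced_rel s' t'.
Proof.
move=> /fsubsetP ss' /fsubsetP tt' st a x /ss' as_ /tt' xt; exact: st.
Qed.

Definition induced_relation :
    poset_relation (face_poset dowker_l) (face_poset dowker_r) :=
  PosetRelation induced_rel_down.

End Dowker.

(* Points of the closed simplex are given by barycentric coordinates. *)
Definition closed_simplex (R : realType) (V : choiceType) (s : {fset V}) :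
    set (V -> R) :=
  [set t | [/\ forall v, 0 <= t v,
               forall v, v \notin s -> t v = 0 &
               \sum_(v <- s) t v = 1]].

Record realization (R : realType) (V : choiceType) (K : simplicial_complex V) :=
  Realization {
    coord : V -> R;
    coordP : (\bigcup_(s in faces K) closed_simplex s) coord
  }.

Section RealizationTopology.
Context (R : realType) (V : choiceType) (K : simplicial_complex V).
Local Notation T := (realization R K).

HB.instance Definition _ := gen_eqMixin T.
HB.instance Definition _ := gen_choiceMixin T.

Definition cell (s : {fset V}) : set T := @coord R V K @^-1` closed_simplex s.

(* Coherent (weak) topology: [U] is open iff its trace on every closed simplex
   is relatively open. On a closed simplex the Euclidean topology is the trace
   of the topology of pointwise convergence, since all but finitely many
   coordinates vanish there. *)
Definition realization_open (U : set T) :=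
  forall s, faces K s -> exists2 B : set {ptws V -> R}, open B &
    U `&` cell s = @coord R V K @^-1` B `&` cell s.

Fact realization_openT : realization_open setT.
Proof. by move=> s _; exists setT; [exact: openT|rewrite preimage_setT]. Qed.

Fact realization_openI : setI_closed realization_open.
Proof.
move=> U U' oU oU' s Ks; have [B oB UB] := oU s Ks.
have [B' oB' UB'] := oU' s Ks; exists (B `&` B'); first exact: openI.
by rewrite preimage_setI [LHS]setIIl UB UB' -setIIl.
Qed.

Fact realization_open_bigU (I : Type) (f : I -> set T) :
  (forall i, realization_open (f i)) -> realization_open (\bigcup_i f i).
Proof.
move=> fo s Ks.
have /choice[B BP] : forall i, exists B : set {ptws V -> R},
    open B /\ f i `&` cell s = @coord R V K @^-1` B `&` cell s.
  by move=> i; have [B oB fB] := fo i s Ks; exists B.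
exists (\bigcup_i B i); first by apply: bigcup_open => i _; case: (BP i).
rewrite preimage_bigcup !setI_bigcupl.
by apply: eq_bigcupr => i _; case: (BP i).
Qed.

HB.instance Definition _ := isOpenTopological.Build T
  realization_openT realization_openI realization_open_bigU.

End RealizationTopology.

Definition homotopic (R : realType) (S T : topologicalType) (f g : S -> T) :=
  exists H : S * R -> T,
    [/\ {within [set: S] `*` `[0, 1], continuous H},
        forall x, H (x, 0) = f x & forall x, H (x, 1) = g x].

Definition homotopy_equivalent (R : realType) (S T : topologicalType) :=
  exists (f : S -> T) (g : T -> S),
    [/\ continuous f, continuous g,
        homotopic R (g \o f) idfun & homotopic R (f \o g) idfun].

(* Main.v *)
(* The inclusion of [D_A] in the join is a strong deformation retract.  Write a
   point of the join as [(alpha, xi)], with level sets [L_t = {x | xi x > t}],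
   and pick for every simplex [L] of [D_X] some [a L] related to all of [L].  At
   time [s] the point is sent to
   [(alpha + sum_L weight_s L * a L, max 0 (xi - s))], renormalised to total mass
   [1], where [weight_s L > 0] forces [L] to be one of the level sets containing
   every [x] with [xi x > s].  All the vertices involved then remain related to
   one another, so the support stays a simplex; at [s = 0] nothing moves, at
   [s = 1] the [X]-part is gone, and points of [D_A] never move.  The [X] side is
   symmetric.  Continuity is checked on each closed simplex times [R], which
   suffices since [R] is locally compact. *)
From mathcomp Require Import all_boot all_order all_algebra finmap.
From mathcomp Require Import all_classical all_reals all_analysis.
Require Import Defs.

Set Implicit Arguments.
Unset Strict Implicit.
Unset Printing Implicit Defensive.

Import Order.TTheory GRing.Theory Num.Theory.
Import numFieldNormedType.Exports.

Local Open Scope fset_scope.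
Local Open Scope classical_set_scope.
Local Open Scope ring_scope.

(* The topology of pointwise convergence, coarser than that of [realization R K]
   but with the same trace on each [cell s]. *)
Definition ptws_realization (R : realType) (V : choiceType)
    (K : simplicial_complex V) : topologicalType :=
  initial_topology (@coord R V K : _ -> {ptws V -> R}).

(** * Continuity on geometric realizations *)

Section RealizationTheory.
Context (R : realType) (V : choiceType) (K : simplicial_complex V).
Local Notation T := (realization R K).
Local Notation W := (ptws_realization R K).
Implicit Types (p q : T) (s : {fset V}).

Lemma coord_inj : injective (@coord R V K).
Proof.
move=> [t tP] [t' t'P] /= tt'; rewrite -{}tt' in t'P *.
by congr Realization; exact: Prop_irrelevance.
Qed.

Lemma ptws_coord_continuous v : continuous (fun p : W => coord p v).
Proof.
move=> p; apply: (@cvg_comp _ _ _ (@coord R V K) (fun t : V -> R => t v) _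
  (nbhs (coord p : {ptws V -> R}))).
  exact: (@initial_continuous T {ptws V -> R}).
exact: (@proj_continuous V (fun=> R)).
Qed.

(** Makes openness in the coherent topology local: it can be tested point by point, along pointwise
    neighbourhoods restricted to a cell. *)
Lemma realization_openP (U : set T) :
  open U <-> forall s p, faces K s -> cell s p -> U p ->
    within (cell s) (nbhs (p : W)) U.
Proof.
split=> [oU s p Ks sp Up|Uloc].
  have [B oB UB] := oU s Ks.
  have : nbhs (p : W) (@coord R V K @^-1` B).
    apply: open_nbhs_nbhs; split; first by exists B.
    by have : (U `&` cell s) p by []; rewrite UB => -[].
  apply: filterS => q Bq sq; have : (@coord R V K @^-1` B `&` cell s) q by [].
  by rewrite -UB => -[].
move=> s Ks.
(* Being open in [W], this interior is the preimage of some open [B]. Adding the complement of the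
   cell does not change the trace on it, and [Uloc] puts every point of [U] on the cell in the
   interior. *)
have [B oB BE] : open ((U `|` ~` cell s : set W)^°) by exact: open_interior.
exists B => //; rewrite {}BE; apply/seteqP; split=> q [].
  move=> Uq sq; split=> //; change (nbhs (q : W) (U `|` ~` cell s)).
  have : nbhs (q : W) [set r | cell s r -> U r] := Uloc s q Ks sq Uq.
  by apply: filterS => r rs; have [/rs|] := pselect (cell s r); [left|right].
by move=> /interior_subset[|] // Uq sq.
Qed.

Lemma realization_continuousP (S : topologicalType) (f : T -> S) :
  (forall s p, faces K s -> cell s p ->
    f q @[q --> within (cell s) (nbhs (p : W))] --> f p) ->
  continuous f.
Proof.
move=> fs; apply/continuousP => U oU; apply/realization_openP => s p Ks sp Up.
by apply: fs => //; exact: open_nbhs_nbhs.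
Qed.

(* Since [R] is locally compact, [T * R] carries the weak topology with respect
   to the sets [cell s `*` setT]; this is the tube lemma. *)
Lemma realization_prod_continuousP (S : topologicalType) (H : T * R -> S) :
  (forall s p (x : R), faces K s -> cell s p ->
    H z @[z --> within [set z | cell s z.1] (nbhs ((p, x) : W * R))]
      --> H (p, x)) ->
  continuous H.
Proof.
move=> Hs; apply/continuousP => U oU.
rewrite openE => -[p x] /= Upx.
have [s Ks sp] := coordP p.
have [e e0 He] : exists2 e : R, 0 < e &
    forall y, `[x - e, x + e]%classic y -> U (H (p, y)).
  have := Hs s p x Ks sp U (open_nbhs_nbhs (conj oU Upx)).
  rewrite nbhs_simpl => -[[P Q] /= [Pp Qx] PQ].
  have /nbhs_ballP[e /= e0 eQ] := Qx.
  exists (e / 2) => [|y]; first by rewrite divr_gt0.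
  rewrite /= in_itv/= -ler_distlC => ye; apply: (PQ (p, y)) => //; split=> //=.
    exact: (nbhs_singleton Pp).
  by apply: eQ; rewrite /ball/=; apply: le_lt_trans ye _; rewrite ltr_pdivrMr// ltr_pMr// ltr1n.
(* The points whose whole slice over the compact interval is sent into [U]. On each cell,
   compactness turns the neighbourhoods found for the single times [y] into one neighbourhood valid
   for all of them. *)
pose V' : set T := [set q | forall y, `[x - e, x + e]%classic y -> U (H (q, y))].
have oV : open V'.
  apply/realization_openP => s' q Ks' s'q Vq.
  have /compact_near_coveringP := @segment_compact R (x - e) (x + e).
  move=> /(_ _ (within (cell s') (nbhs (q : W))) (fun q y => U (H (q, y)))).
  apply => y exy.
  have := Hs s' q y Ks' s'q U (open_nbhs_nbhs (conj oU (Vq y exy))).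
  rewrite nbhs_simpl => -[[P Q] /= [Pp Qy] PQ].
exists (Q, [set r | cell s' r /\ P r]).
    split=> //=; rewrite nbhs_simpl.
    by have : nbhs (q : W) P := Pp; apply: filterS => r Pr rs.
  by move=> [z r] /= [Qz [rs Pr]]; exact: (PQ (r, z)).
have : nbhs (p, x) (V' `*` `[x - e, x + e]%classic).
  exists (V', `[x - e, x + e]%classic) => //; split=> /=; first by apply: open_nbhs_nbhs.
  apply: filterS (nbhsx_ballx x e e0) => y; rewrite /ball/= in_itv/= -ler_distlC.
  exact: ltW.
by apply: filterS => -[q y] [/= Vq ey]; exact: Vq.
Qed.

Lemma ptws_realization_cvg (Z : Type) (G : set_system Z) (g : Z -> T) p :
  Filter G -> (forall v, coord (g z) v @[z --> G] --> coord p v) ->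
  g @ G --> (p : W).
Proof.
move=> FG gv A /=; rewrite nbhsE => -[_ [[B oB <-] Bp] BA].
have gB : {ptws, (fun z => coord (g z)) @ G --> coord p}.
  apply/cvg_sup => v N [_ [[C oC <-] Cp] CN]; apply: (filterS CN).
  exact: (gv v _ (open_nbhs_nbhs (conj oC Cp))).
have GB : G [set z | B (coord (g z))].
  by apply: (gB B); exact: (open_nbhs_nbhs (conj oB Bp)).
rewrite nbhs_simpl; apply: filterS GB => z; exact: BA.
Qed.

(** The total mass over all of [V] does not mention [s], so that for points of the realization
    membership in a cell only depends on where coordinates vanish. *)
Lemma closed_simplexE s (t : V -> R) :
  closed_simplex s t <-> [/\ forall v, 0 <= t v,
    forall v, v \notin s -> t v = 0 & \sum_(v \in [set: V]) t v = 1].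
Proof.
by split=> -[t0 ts t1]; split=> //; move: t1; rewrite (fsbigTE s).
Qed.

Lemma coord_ge0 p v : 0 <= coord p v.
Proof. by have [s _ []] := coordP p. Qed.

Lemma sum_coord p : \sum_(v \in [set: V]) coord p v = 1.
Proof. by have [s _ /closed_simplexE[]] := coordP p. Qed.

Lemma cellP s p : cell s p <-> forall v, v \notin s -> coord p v = 0.
Proof.
split=> [[]//|ps]; apply/closed_simplexE; split=> //.
- exact: coord_ge0.
- exact: sum_coord.
Qed.

(** A simplex carrying [p] can be cut down to its intersection with [F]; this is non-empty because
    the coordinates of [p] sum to 1. *)
Lemma faces_cell (F : {fset V}) p : (forall v, v \notin F -> coord p v = 0) ->
  exists s, [/\ faces K s, (s `<=` F)%fset & cell s p].
Proof.
move=> pF; have [s Ks sp] := coordP p.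
have sFp : cell (s `&` F)%fset p.
  apply/cellP => v; rewrite inE negb_and => /orP[|/pF//].
  by case: sp => _ + _ => /[apply].
exists (s `&` F)%fset; split=> //; last exact: fsubsetIr.
apply: faces_down Ks (fsubsetIl _ _) _; apply: contra_eq_neq (sum_coord p) => sF0.
rewrite fsbig1 1?eq_sym ?oner_eq0// => v _; move/cellP : sFp; apply.
by rewrite sF0.
Qed.

Lemma coord_le1 p v : coord p v <= 1.
Proof.
have [s _ /cellP sp] := coordP p; rewrite -(sum_coord p) (fsbigTE s)//.
have [vs|/sp ->] := boolP (v \in s); last first.
  by rewrite sumr_ge0// => w _; exact: coord_ge0.
by rewrite (big_fsetD1 v)//= lerDl sumr_ge0// => w _; exact: coord_ge0.
Qed.

(** Once the supports eventually stay in one finite set, only finitely many simplices matter, and on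
    each of them the coherent and the pointwise topology agree. *)
Lemma realization_cvg (Z : Type) (G : set_system Z) (g : Z -> T) p
    (F : {fset V}) : Filter G ->
  (forall v, v \notin F -> coord p v = 0) ->
  (\forall z \near G, forall v, v \notin F -> coord (g z) v = 0) ->
  (forall v, v \in F -> coord (g z) v @[z --> G] --> coord p v) ->
  g @ G --> p.
Proof.
move=> FG pF gF gv.
have gv' v : coord (g z) v @[z --> G] --> coord p v.
  have [/gv//|vF] := boolP (v \in F).
  rewrite pF//; apply: cvg_near_cst; apply: filterS gF => z; exact.
have gp : g @ G --> (p : W) by exact: ptws_realization_cvg.
move=> U; rewrite nbhsE => -[B [oB Bp] BU]; rewrite nbhs_simpl.
have Gs s : G [set z | faces K s -> cell s (g z) -> B (g z)].
  have [Ks|nKs] := pselect (faces K s); last by apply: nearW => z /nKs.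
  (* If [p] is not in the cell, some coordinate outside [s] is nonzero at [p], hence eventually
     nonzero along [G]: [g z] leaves the cell and the condition becomes vacuous. *)
  have [sp|/cellP/existsNP[v /not_implyP[vs /eqP pv]]] := pselect (cell s p).
    move/realization_openP : oB => /(_ s p Ks sp Bp) => sO.
    have Gs : G [set z | cell s (g z) -> B (g z)] := gp _ sO.
    by apply: filterS Gs => z + _.
  have nz : nbhs (coord p v) [set x : R | x != 0].
    exact: (open_nbhs_nbhs (conj (@open_neq R 0) pv)).
  have : G [set z | coord (g z) v != 0] := gv' v _ nz.
  by apply: filterS => z gz _ /cellP/(_ v vs)/eqP; rewrite (negbTE gz).
have := @filter_bigI _ _ (fpowerset F) _ G FG (fun s _ => Gs s).
apply: filterS2 gF => z /faces_cell[s [Ks sF sz]] Bz; apply: BU.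
by apply: (Bz s) => //=; rewrite fpowersetE.
Qed.

End RealizationTheory.

(** * The flow *)

Section Normalize.
Context (R : realType) (V : choiceType) (K : simplicial_complex V).

Lemma realization_supp (p : realization R K) :
  exists2 u, faces K u & forall v, (v \in u) = (coord p v != 0).
Proof.
have [s Ks /cellP sp] := coordP p.
have pu v : v \notin [fset v in s | coord p v != 0]%fset -> coord p v = 0.
  by rewrite !inE negb_and negbK => /orP[/sp|/eqP].
have [u [Ku /fsubsetP us /cellP up]] := faces_cell pu.
exists u => // v; apply/idP/idP => [/us|]; first by rewrite !inE => /andP[].
by apply: contraNT => /up ->.
Qed.

Lemma normalize_subproof (u : V -> R) (F : {fset V}) :
  (forall v, 0 <= u v) -> (forall v, v \notin F -> u v = 0) ->
  (exists v, u v != 0) ->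
  (forall s, s != fset0 -> (forall v, v \in s -> u v != 0) -> faces K s) ->
  (\bigcup_(s in faces K) closed_simplex s)
    (fun v => u v / \sum_(w \in [set: V]) u w).
Proof.
move=> u0 uF [v0 uv0] uK.
have uS v : v \notin [fset v in F | u v != 0]%fset -> u v = 0.
  by rewrite !inE negb_and negbK => /orP[/uF|/eqP].
have sum_gt0 : 0 < \sum_(w \in [set: V]) u w.
  rewrite (fsbigTE F)// lt_neqAle sumr_ge0 ?andbT// eq_sym.
  apply: contra_neq uv0 => /eqP; rewrite psumr_eq0// => /allP uF0.
  by have [/uF0/eqP//|/uF] := boolP (v0 \in F).
exists [fset v in F | u v != 0]%fset.
  apply: uK => [|v]; last by rewrite !inE => /andP[].
  by apply/fset0Pn; exists v0; apply: contraNT uv0 => /uS ->.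
apply/closed_simplexE; split=> [v|v /uS ->|].
- by rewrite divr_ge0// ltW.
- by rewrite mul0r.
- by rewrite -mulr_fsuml divff// gt_eqF.
Qed.

End Normalize.

Lemma bigmin_le_seq (R : realType) (I : eqType) (x : R) (r : seq I)
    (t : I -> R) i : i \in r -> \big[Num.min/x]_(j <- r) t j <= t i.
Proof.
elim: r => // j r IHr; rewrite inE big_cons ge_min => /orP[/eqP ->|/IHr ->].
  by rewrite lexx.
by rewrite orbT.
Qed.

Lemma cvg_minr (R : realType) (Z : Type) (G : set_system Z) (f g : Z -> R) a b :
  Filter G -> f @ G --> a -> g @ G --> b ->
  Num.min (f z) (g z) @[z --> G] --> Num.min a b.
Proof.
move=> FG fa gb.
apply: (cvg_comp2 fa gb (h := fun a b : R => Num.min a b)).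
exact: (@min_continuous _ R (a, b)).
Qed.

Lemma cvg_maxr (R : realType) (Z : Type) (G : set_system Z) (f g : Z -> R) a b :
  Filter G -> f @ G --> a -> g @ G --> b ->
  Num.max (f z) (g z) @[z --> G] --> Num.max a b.
Proof.
move=> FG fa gb.
apply: (cvg_comp2 fa gb (h := fun a b : R => Num.max a b)).
exact: (@max_continuous _ R (a, b)).
Qed.

Section Flow.
Context (R : realType) (W : choiceType) (J : simplicial_complex W).
Context (right : pred W) (c : {fset W} -> {fset W}).

(* [right] singles out the vertices to be emptied; the weight of a set [L] of
   right vertices is spread over the vertices in [c L].  Time enters through
   [`|x|], so that the homotopy makes sense for every real [x]. *)
Definition weight (t : W -> R) (x : R) (L : {fset W}) : R :=
  Num.max 0 (\big[Num.min/`|x|]_(y <- L) t y -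
    \sum_(y \in [set: W]) (if right y && (y \notin L) then t y else 0)).

Definition contributes (w : W) (L : {fset W}) :=
  [&& L != fset0, all right L & w \in c L].

Definition flow (t : W -> R) (x : R) (w : W) : R :=
  (if right w then Num.max 0 (t w - `|x|) else t w) +
  \sum_(L \in [set: {fset W}]) (if contributes w L then weight t x L else 0).

Lemma weight_ge0 t x L : 0 <= weight t x L.
Proof. by rewrite le_max lexx. Qed.

Implicit Types (p : realization R J) (x : R) (L s : {fset W}).

(** The minimum over [L], capped by [|x|], exceeds the total right mass outside [L], which in turn
    bounds each of its terms. A set [L] of right vertices is then a superlevel set containing every
    right vertex of coordinate at least [|x|]. *)
Lemma weight_gt0P p x L : 0 < weight (coord p) x L ->
  [/\ forall y, y \in L -> 0 < coord p y,
      forall y z, y \in L -> right z -> z \notin L -> coord p z < coord p y,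
      forall z, right z -> z \notin L -> coord p z < `|x| & 0 < `|x|].
Proof.
rewrite /weight; set m := bigop _ _ _; set r := \sum_(_ \in _) _.
rewrite lt_max ltxx/= subr_gt0 => rm.
have [s _ /cellP sp] := coordP p.
have rE : r = \sum_(y <- s) (if right y && (y \notin L) then coord p y else 0).
  by apply: fsbigTE => y /sp ->; rewrite if_same.
have rge z : right z -> z \notin L -> coord p z <= r.
  move=> rz zL; have [zs|/sp ->] := boolP (z \in s); last first.
    by rewrite rE sumr_ge0// => y _; case: ifP => // _; exact: coord_ge0.
  rewrite rE (big_fsetD1 z)//= rz zL lerDl sumr_ge0// => y _.
  by case: ifP => // _; exact: coord_ge0.
have r0 : 0 <= r.
  by rewrite rE sumr_ge0// => y _; case: ifP => // _; exact: coord_ge0.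
split=> [y yL|y z yL rz zL|z rz zL|].
- exact: le_lt_trans (lt_le_trans rm (bigmin_le_seq _ _ yL)).
- exact: le_lt_trans (rge z rz zL) (lt_le_trans rm (bigmin_le_seq _ _ yL)).
- exact: le_lt_trans (rge z rz zL) (lt_le_trans rm (bigmin_le_id _ _ _ _)).
- exact: le_lt_trans (lt_le_trans rm (bigmin_le_id _ _ _ _)).
Qed.

Lemma weight_eq0 p x L y : y \in L -> coord p y = 0 -> weight (coord p) x L = 0.
Proof.
move=> yL py; apply/eqP; rewrite eq_le weight_ge0 andbT leNgt.
by apply/negP => /weight_gt0P[/(_ y yL)]; rewrite py ltxx.
Qed.

Lemma weightE p x s L : cell s p -> weight (coord p) x L =
  Num.max 0 (\big[Num.min/`|x|]_(y <- L) coord p y -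
    \sum_(y <- s) (if right y && (y \notin L) then coord p y else 0)).
Proof.
move=> /cellP sp; rewrite /weight; congr (Num.max 0 (_ - _)).
by apply: fsbigTE => y /sp ->; rewrite if_same.
Qed.

(** A positive weight needs positive coordinates on all of [L], so only the subsets of [s] count.
    One finite formula thus holds on the whole cell, and continuity is read off from it. *)
Lemma flowE p x s w : cell s p -> flow (coord p) x w =
  (if right w then Num.max 0 (coord p w - `|x|) else coord p w) +
  \sum_(L <- fpowerset s)
    (if contributes w L then weight (coord p) x L else 0).
Proof.
move=> /cellP sp; congr (_ + _); apply: fsbigTE => L.
rewrite fpowersetE => /fsubsetPn[y yL ys].
by rewrite (weight_eq0 _ yL) ?if_same ?sp.
Qed.

Lemma flow_ge0 p x w : 0 <= flow (coord p) x w.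
Proof.
have [s _ sp] := coordP p; rewrite (flowE _ _ sp) addr_ge0//.
  by case: ifP => _; rewrite ?coord_ge0// le_max lexx.
by apply: sumr_ge0 => L _; case: ifP => // _; exact: weight_ge0.
Qed.

(** Nothing cancels, all summands being nonnegative; this describes the support of the flow. *)
Lemma flow_neq0P p x w : flow (coord p) x w != 0 <->
  [\/ ~~ right w /\ coord p w != 0, right w /\ `|x| < coord p w |
    exists2 L, contributes w L & 0 < weight (coord p) x L].
Proof.
have [s _ sp] := coordP p; rewrite (flowE _ _ sp).
set a := if _ then _ else _; set b := bigop _ _ _.
have a0 : 0 <= a by rewrite /a; case: ifP => _; rewrite ?coord_ge0// le_max lexx.
have bi L : 0 <= (if contributes w L then weight (coord p) x L else 0).
  by case: ifP => // _; exact: weight_ge0.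
have b0 : 0 <= b by exact: sumr_ge0.
rewrite paddr_eq0// negb_and; split.
  move=> /orP[]; rewrite /a /b.
    case: ifP => [rw|_]; last by constructor 1.
    rewrite -/a => an0; constructor 2; split=> //; move: an0.
    by apply: contra_neqT; rewrite -leNgt => ?; apply/max_idPl; rewrite subr_le0.
  rewrite psumr_eq0// => /allPn[L _]; case: ifP => [wL L0|]; last by rewrite eqxx.
  by constructor 3; exists L => //; rewrite lt_neqAle eq_sym L0 weight_ge0.
case=> [[/negbTE wr pw]|[wr xw]|[L wL L0]].
- by rewrite /a wr pw.
- by rewrite /a wr gt_eqF// lt_max subr_gt0 xw orbT.
- apply/orP; right; rewrite psumr_eq0//; apply/allPn; exists L; last first.
    by rewrite wL gt_eqF.
  have /weight_gt0P[Lp _ _ _] := L0; rewrite fpowersetE; apply/fsubsetP => y /Lp.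
  by apply: contraTT => ys; rewrite -leNgt; move/cellP : sp => ->.
Qed.

(** A finite bound on the support that is uniform over the cell and over time, as [realization_cvg]
    requires. *)
Definition flow_supp s : {fset W} :=
  (s `|` \bigcup_(L <- fpowerset s) c L)%fset.

Lemma flow_suppP p x s w : cell s p -> w \notin flow_supp s ->
  flow (coord p) x w = 0.
Proof.
move=> /cellP sp; rewrite inE negb_or => /andP[/sp pw wc]; apply/eqP.
apply: contraNT wc => /flow_neq0P[[_]|[_]|[L]].
- by rewrite pw eqxx.
- by rewrite pw normr_lt0.
- move=> /and3P[_ _ wL] /weight_gt0P[Lp _ _ _]; apply/bigfcupP; exists L => //.
  rewrite andbT fpowersetE; apply/fsubsetP => y /Lp.
  by apply: contraTT => /sp ->; rewrite ltxx.
Qed.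

(** Point and time run along an arbitrary filter so that, through [flow_point_cvg], both the
    homotopy and the retraction at fixed time 1 are covered. *)
Lemma flow_cvg (Z : Type) (G : set_system Z) (q : Z -> realization R J)
    (y : Z -> R) p x s w : Filter G ->
  (forall v, coord (q z) v @[z --> G] --> coord p v) -> y @ G --> x ->
  (\forall z \near G, cell s (q z)) -> cell s p ->
  flow (coord (q z)) (y z) w @[z --> G] --> flow (coord p) x w.
Proof.
move=> FG qp yx sq sp.
rewrite (flowE _ _ sp).
apply: (@cvg_trans _ ((if right w then Num.max 0 (coord (q z) w - `|y z|)
    else coord (q z) w) +
  \sum_(L <- fpowerset s) (if contributes w L then
    Num.max 0 (\big[Num.min/`|y z|]_(y <- L) coord (q z) y -
    \sum_(y <- s) (if right y && (y \notin L) then coord (q z) y else 0)) else 0)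
    @[z --> G])).
  apply: near_eq_cvg; apply: filterS sq => z sz; rewrite (flowE _ _ sz).
  congr (_ + _); apply: eq_bigr => L _; case: ifP => // _.
  by rewrite (weightE _ _ sz).
have yn : `|y z| @[z --> G] --> `|x| by exact: cvg_norm.
apply: cvgD.
  case: ifP => _; last exact: qp.
  by apply: cvg_maxr; [exact: cvg_cst|exact: cvgB].
apply: cvg_big => [|L _]; first exact: add_continuous.
case: ifP => _; last exact: cvg_cst.
rewrite (weightE _ _ sp); apply: cvg_maxr; first exact: cvg_cst.
apply: cvgB.
  elim: (enum_fset L) => [|j r IHr]; rewrite ?(big_nil, big_cons).
    by under eq_cvg do rewrite big_nil.
  by under eq_cvg do rewrite big_cons; apply: cvg_minr.
apply: cvg_big => [|v _]; first exact: add_continuous.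
by case: ifP => _; [exact: qp|exact: cvg_cst].
Qed.

End Flow.

(** * The normalised flow as a continuous map *)

Section FlowPoint.
Context (R : realType) (W : choiceType) (J : simplicial_complex W).
Context (right : pred W) (c : {fset W} -> {fset W}).
Context (c_neq0 : forall L, faces J L -> (forall w, w \in L -> right w) ->
  c L != fset0).
(** Here [u] plays the support of a point, [r] a set of right vertices common to all contributing
    [L], and [e] a set of vertices in the support after the flow. *)
Context (c_face : forall u r e : {fset W}, faces J u -> r != fset0 ->
  (forall w, w \in r -> right w /\ w \in u) -> e != fset0 ->
  (forall w, w \in e -> [\/ ~~ right w /\ w \in u, w \in r |
    exists2 L, (r `<=` L)%fset & w \in c L]) ->
  faces J e).

Implicit Types (p : realization R J) (x : R).
Local Notation flow := (flow right c).

Lemma flow_exists p x : exists w, flow (coord p) x w != 0.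
Proof.
have [u Ju uP] := realization_supp p.
have /fset0Pn[w wu] := faces_neq0 Ju.
have [/allP/= ur|/allPn[v vu vr]] := boolP (all right u); last first.
  by exists v; apply/flow_neq0P; constructor 1; rewrite -uP.
have [x0|xn0] := eqVneq x 0.
  exists w; apply/flow_neq0P; constructor 2; split; first exact: ur.
  by rewrite x0 normr0 lt_neqAle eq_sym -uP wu coord_ge0.
(* With all mass on the right and [x != 0], the full support [u] has positive weight: no right mass
   lies outside it, and its coordinates and [|x|] are positive. *)
have /fset0Pn[v vc] := c_neq0 Ju ur.
exists v; apply/flow_neq0P; constructor 3; exists u.
  by apply/and3P; split; [exact: faces_neq0 Ju|exact/allP|].
rewrite /weight lt_max; apply/orP; right.
rewrite fsbig1 ?subr0 => [|y _]; last first.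
  by case: ifP => // /andP[_]; rewrite uP negbK => /eqP.
have {}uP y : y \in enum_fset u -> 0 < coord p y.
  by move=> yu; rewrite lt_neqAle coord_ge0 andbT eq_sym -uP.
elim: (enum_fset u) uP => [|y r IHr] rP.
  by rewrite big_nil normr_gt0.
rewrite big_cons lt_min rP ?mem_head// IHr// => z zr; apply: rP.
by rewrite inE zr orbT.
Qed.

(* The right vertex of largest coordinate lies in every contributing [L]. *)
Lemma flow_faces p x e : e != fset0 ->
  (forall w, w \in e -> flow (coord p) x w != 0) -> faces J e.
Proof.
move=> e0 eP; have [u Ju uP] := realization_supp p.
have gt0 w : (w \in u) = (0 < coord p w).
  by rewrite uP lt_neqAle coord_ge0 andbT eq_sym.
have [/hasP[y0 y0u ry0]|/hasPn/= nr] := boolP (has right u); last first.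
  apply: (faces_down Ju) => //; apply/fsubsetP => w /eP /flow_neq0P[].
  - by case=> _; rewrite uP.
  - by case=> _ xw; rewrite gt0; exact: le_lt_trans xw.
  case=> L /and3P[/fset0Pn[y yL] /allP/(_ y yL) ry _] /weight_gt0P[Lp _ _ _].
  have yu : y \in u by rewrite gt0 Lp.
  by have := nr y yu; rewrite ry.
have [m mu [rm mP]] : exists2 m, m \in u & right m /\
    forall y, y \in u -> right y -> coord p y <= coord p m.
  pose i0 : u := [` y0u]%fset.
  pose i := [arg max_(i > i0 | right (val i)) coord p (val i)]%O.
  exists (val i); first exact: valP.
  rewrite /i; case: Order.TotalTheory.arg_maxP => //= j rj jP; split=> // y yu ry.
  exact: (jP [` yu]%fset).
(* The vertex [m] is added by hand: it keeps [r] non-empty even when the truncation empties every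
   right vertex. *)
pose r := (m |` [fset y in u | right y && (`|x| < coord p y)])%fset.
have rP y : y \in r -> right y /\ y \in u.
  by rewrite !inE => /orP[/eqP ->//|/and3P[-> -> _]].
apply: (@c_face u r) => //; first by apply/fset0Pn; exists m; rewrite !inE eqxx.
move=> w /eP /flow_neq0P[].
- by move=> [wr pw]; constructor 1; rewrite uP.
- move=> [wr xw]; constructor 2; rewrite !inE wr xw gt0 andbT.
  by rewrite (le_lt_trans _ xw)// orbT.
move=> [L /and3P[/fset0Pn[y yL] /allP/= Lr wL] /weight_gt0P[Lp Llt Lx _]].
constructor 3; exists L => //; apply/fsubsetP => z.
rewrite !inE => /orP[/eqP ->|/and3P[_ rz xz]].
  apply: contraT => mL; have := Llt y m yL rm mL.
  by rewrite ltNge mP ?Lr// gt0 Lp.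
by apply: contraT => zL; have := Lx z rz zL; rewrite ltNge ltW.
Qed.

Lemma flow_point_subproof (z : realization R J * R) :
  (\bigcup_(s in faces J) closed_simplex s) (fun w => flow (coord z.1) z.2 w /
    \sum_(v \in [set: W]) flow (coord z.1) z.2 v).
Proof.
case: z => p x /=; have [s _ sp] := coordP p.
apply: (@normalize_subproof _ _ _ _ (flow_supp c s)).
- by move=> w; exact: flow_ge0.
- by move=> w; exact: flow_suppP.
- exact: flow_exists.
- by move=> e e0; exact: flow_faces.
Qed.

Definition flow_point (z : realization R J * R) : realization R J :=
  Realization (flow_point_subproof z).

(** As the inverse of 0 is 0, a zero total would make every coordinate of [flow_point] vanish,
    against their sum 1. *)
Lemma flow_total_neq0 p x : \sum_(v \in [set: W]) flow (coord p) x v != 0.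
Proof.
apply: contra_eq_neq (sum_coord (flow_point (p, x))) => /= ->.
by rewrite fsbig1 1?eq_sym ?oner_eq0// => w _; rewrite invr0 mulr0.
Qed.

Lemma flow_point_cvg (Z : Type) (G : set_system Z) (q : Z -> realization R J)
    (y : Z -> R) p x s w : Filter G ->
  (forall v, coord (q z) v @[z --> G] --> coord p v) -> y @ G --> x ->
  (\forall z \near G, cell s (q z)) -> cell s p ->
  coord (flow_point (q z, y z)) w @[z --> G] --> coord (flow_point (p, x)) w.
Proof.
move=> FG qp yx sq sp; rewrite /=; apply: cvgM; first exact: flow_cvg qp yx sq sp.
apply: cvgV; first exact: flow_total_neq0.
rewrite (fsbigTE (flow_supp c s)) => [|v]; last exact: flow_suppP.
apply: (@cvg_trans _ (\sum_(v <- flow_supp c s) flow (coord (q z)) (y z) v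
    @[z --> G])).
  apply: near_eq_cvg; apply: filterS sq => z sz; rewrite (fsbigTE (flow_supp c s))//.
  by move=> v; exact: flow_suppP.
apply: cvg_big => [|v _]; first exact: add_continuous.
exact: flow_cvg qp yx sq sp.
Qed.

Lemma flow_point_supp p x s w : cell s p -> w \notin flow_supp c s ->
  coord (flow_point (p, x)) w = 0.
Proof. by move=> sp ws; rewrite /= (flow_suppP _ _ sp ws) mul0r. Qed.

Lemma flow_point_continuous : continuous flow_point.
Proof.
apply: realization_prod_continuousP => s p x Js sp.
apply: (@realization_cvg _ _ _ _ _ _ _ (flow_supp c s)).
- by move=> w; exact: flow_point_supp.
- rewrite near_withinE; apply: nearW => -[q y] /= sq w ws.
  exact: flow_point_supp sq ws.
- move=> w _; apply: (@flow_point_cvg _ _ fst snd p x s w) => //.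
  + move=> v; apply: cvg_within_filter.
    apply: (@cvg_comp _ _ _ fst (fun q => coord q v) _
      (nbhs (p : ptws_realization R J))); first exact: cvg_fst.
    exact: ptws_coord_continuous.
  + by apply: cvg_within_filter; exact: cvg_snd.
  + by rewrite near_withinE; apply: nearW.
Qed.

Lemma flow_id p x : (forall L w, contributes right c w L ->
    weight right (coord p) x L = 0) ->
  (forall w, right w -> Num.max 0 (coord p w - `|x|) = coord p w) ->
  flow_point (p, x) = p.
Proof.
move=> L0 wx; apply: coord_inj; apply/funext => w /=.
have flow_id v : flow (coord p) x v = coord p v.
  rewrite /flow fsbig1 ?addr0 => [|L _]; first by case: ifP => // /wx.
  by case: ifP => // /L0.
by rewrite flow_id; under eq_fsbigr do rewrite flow_id; rewrite sum_coord divr1.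
Qed.

Lemma flow_point0 p : flow_point (p, 0) = p.
Proof.
apply: flow_id => [L w _|w _]; last first.
  by rewrite normr0 subr0; apply/max_idPr; exact: coord_ge0.
apply/eqP; rewrite eq_le weight_ge0 andbT leNgt; apply/negP.
by move=> /weight_gt0P[_ _ _]; rewrite normr0 ltxx.
Qed.

Lemma flow_point_left p x : (forall w, right w -> coord p w = 0) ->
  flow_point (p, x) = p.
Proof.
move=> pr; apply: flow_id => [L w|w /pr ->]; last first.
  by apply/max_idPl; rewrite sub0r oppr_le0.
move=> /and3P[/fset0Pn[y yL] /allP/(_ y yL) ry _].
by rewrite (weight_eq0 _ _ yL)// pr.
Qed.

(** No coordinate exceeds 1, so time 1 truncates all right mass, and what is redistributed lands on
    left vertices. *)
Lemma flow_point1 p w : (forall L v, v \in c L -> ~~ right v) -> right w ->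
  coord (flow_point (p, 1)) w = 0.
Proof.
move=> cl wr; rewrite /= [X in X / _](_ : _ = 0) ?mul0r//; apply/eqP.
apply/negP => /negP/flow_neq0P[[]|[_]|[L /and3P[_ _ /cl]]]; rewrite ?wr//.
by rewrite normr1 ltNge coord_le1.
Qed.

End FlowPoint.

(** * The deformation retraction *)

Section Deformation.
Context (R : realType) (W : choiceType) (J : simplicial_complex W).
Context (V : choiceType) (K : simplicial_complex V).
(** With [faces_i], this presents [K] as the full subcomplex of [J] on the image of [i]; the right
    vertices are those where the partial inverse [j] is undefined. *)
Context (i : V -> W) (j : W -> option V) (ij : pcancel i j) (ji : ocancel j i).
Context (faces_i : forall s, faces K s <-> faces J (i @` s)%fset).
Context (c : {fset W} -> {fset W}).
Local Notation right := (fun w => ~~ j w).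
Context (c_left : forall L w, w \in c L -> j w).
Context (c_neq0 : forall L, faces J L -> (forall w, w \in L -> ~~ j w) ->
  c L != fset0).
Context (c_face : forall u r e : {fset W}, faces J u -> r != fset0 ->
  (forall w, w \in r -> ~~ j w /\ w \in u) -> e != fset0 ->
  (forall w, w \in e -> [\/ ~~ ~~ j w /\ w \in u, w \in r |
    exists2 L, (r `<=` L)%fset & w \in c L]) ->
  faces J e).

Lemma sum_left (t : W -> R) : (forall w, ~~ j w -> t w = 0) ->
  \sum_(w \in [set: W]) t w = \sum_(v \in [set: V]) t (i v).
Proof.
move=> t0; rewrite -(fsbig_image [set: V] i t); last first.
  by move=> x y _ _ /(pcan_inj ij).
apply/esym/fsbig_widen => // w [_ wi]; apply: t0.
by apply/negP => jw; apply: wi; move: (ji w) jw; case: (j w) => // v <- _; exists v.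
Qed.

Lemma push_subproof (p : realization R K) :
  (\bigcup_(s in faces J) closed_simplex s) (fun w => oapp (coord p) 0 (j w)).
Proof.
have [s Ks sp] := coordP p; exists (i @` s)%fset; first exact/faces_i.
have /cellP {}sp : cell s p by [].
apply/closed_simplexE; split=> [w|w ws|].
- by case: (j w) => //= v; exact: coord_ge0.
- move: (ji w) ws; case: (j w) => //= v <-; rewrite mem_imfset//=; last exact: pcan_inj ij.
  exact: sp.
- rewrite sum_left => [|w]; last by case: (j w).
  by under eq_fsbigr do rewrite ij /=; rewrite sum_coord.
Qed.

Definition push p : realization R J := Realization (push_subproof p).

Lemma pull_subproof (p : realization R J) :
  (forall w, ~~ j w -> coord p w = 0) ->
  (\bigcup_(s in faces K) closed_simplex s) (fun v => coord p (i v)).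
Proof.
move=> pr; have [u Ju uP] := realization_supp p.
exists [fset v in pmap j u]%fset; last first.
  apply/closed_simplexE; split=> [v|v|]; first exact: coord_ge0.
    rewrite !inE/= mem_pmap; apply: contraNeq; rewrite -uP => iu.
    by apply/mapP; exists (i v); rewrite ?ij.
  by rewrite -sum_left// sum_coord.
apply/faces_i; rewrite (_ : (_ @` _)%fset = u)//; apply/fsetP => w.
apply/imfsetP/idP => /= [[v]|wu].
  by rewrite !inE/= mem_pmap => /mapP[x xu vx] ->; move: (ji x); rewrite -vx /= => ->.
have : j w by apply: contraLR wu => /pr; rewrite uP negbK => ->.
move: (ji w); case jw: (j w) => [v|]//= iv _; exists v => //.
by rewrite !inE/= mem_pmap; apply/mapP; exists w.
Qed.

Local Notation H := (@flow_point R W J right c c_neq0 c_face).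

Lemma flow_right0 q w : ~~ j w -> coord (H (q, 1)) w = 0.
Proof.
move=> jw; apply: flow_point1 => //= L v vL; apply/negPn; exact: c_left vL.
Qed.

Definition retract q : realization R K := Realization (pull_subproof (flow_right0 q)).

Lemma push_continuous : continuous push.
Proof.
apply: realization_continuousP => s p Ks /cellP sp.
have pushF q w : cell s q -> w \notin (i @` s)%fset -> coord (push q) w = 0.
  move=> /cellP sq; rewrite /=; move: (ji w); case: (j w) => //= v <-.
  by rewrite mem_imfset//=; [exact: sq|exact: pcan_inj ij].
apply: (@realization_cvg _ _ _ _ _ _ _ (i @` s)%fset).
- by move=> w; apply: pushF; exact/cellP.
- by rewrite near_withinE; apply: nearW => q sq w; exact: pushF.
- move=> w _; apply: cvg_within_filter; rewrite /=; case: (j w) => [v|] /=.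
    exact: ptws_coord_continuous.
  exact: cvg_cst.
Qed.

Lemma retract_continuous : continuous retract.
Proof.
apply: realization_continuousP => s p Ks sp.
pose F := [fset v in pmap j (flow_supp c s)]%fset.
have retractF q v : cell s q -> v \notin F -> coord (retract q) v = 0.
  move=> sq vF; rewrite -[LHS]/(coord (H (q, 1)) (i v)).
  apply: (flow_point_supp _ _ _ sq); apply: contraNN vF => iv.
  by rewrite !inE/= mem_pmap; apply/mapP; exists (i v); rewrite ?ij.
apply: (@realization_cvg _ _ _ _ _ _ _ F).
- by move=> v; exact: retractF.
- by rewrite near_withinE; apply: nearW => q sq w; exact: retractF.
- move=> v _; apply: (@flow_point_cvg _ _ _ _ _ _ _ _ _ id (fun=> 1) p 1 s (i v)) => //.
  + by move=> w; apply: cvg_within_filter; exact: ptws_coord_continuous.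
  + exact: cvg_cst.
  + by rewrite near_withinE; apply: nearW.
Qed.

Lemma pushK : cancel push retract.
Proof.
move=> p; apply: coord_inj; apply/funext => v.
rewrite /retract -[LHS]/(coord (H (push p, 1)) (i v)) flow_point_left.
  by rewrite /= ij.
by move=> w /=; case: (j w).
Qed.

Lemma retractK q : push (retract q) = H (q, 1).
Proof.
apply: coord_inj; apply/funext => w.
rewrite -[LHS]/(oapp (fun v => coord (H (q, 1)) (i v)) 0 (j w)).
by have := @flow_right0 q w; move: (ji w); case: (j w) => /= [v <-//|_ ->].
Qed.

Lemma deformation_equivalence :
  homotopy_equivalent R (realization R K) (realization R J).
Proof.
exists push, retract; split.
- exact: push_continuous.
- exact: retract_continuous.
- exists fst; split=> [|p|p]//=; last by rewrite pushK.
  by apply: continuous_subspaceT => z; exact: cvg_fst.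
(* Time is reversed because the flow starts at the identity, whereas this homotopy has to end
   there. *)
exists (fun z => H (z.1, 1 - z.2)); split=> [|q|q] /=.
- apply: continuous_subspaceT => z.
  have f1 : y.1 @[y --> z] --> z.1 by exact: cvg_fst.
  have f2 : 1 - y.2 @[y --> z] --> 1 - z.2.
    by apply: cvgB; [exact: cvg_cst|exact: cvg_snd].
  have f12 : (y.1, 1 - y.2) @[y --> z] --> (z.1, 1 - z.2).
    exact: cvg_pair f1 f2.
  exact: cvg_comp f12 (@flow_point_continuous _ _ _ _ _ _ _ _).
- by rewrite subr0 retractK.
- by rewrite subrr flow_point0.
Qed.

End Deformation.

Lemma homotopy_equivalent_sym (R : realType) (S T : topologicalType) :
  homotopy_equivalent R S T -> homotopy_equivalent R T S.
Proof. by move=> [f [g [? ? ? ?]]]; exists g, f. Qed.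

(** * Dowker complexes *)

(** A choice with at most one element; the empty set stands for the absence of a candidate, so that
    [c] can be defined on every finite set. *)
Definition pick_fset (T : choiceType) (P : set T) : {fset T} :=
  if pselect (exists x, P x) is left exP then [fset projT1 (cid exP)]%fset
  else fset0.

Lemma pick_fsetP (T : choiceType) (P : set T) x : x \in pick_fset P -> P x.
Proof.
by rewrite /pick_fset; case: pselect => [exP|]//; rewrite !inE => /eqP ->; case: cid.
Qed.

Lemma pick_fset_neq0 (T : choiceType) (P : set T) :
  (exists x, P x) -> pick_fset P != fset0.
Proof.
move=> exP; rewrite /pick_fset; case: pselect => // ?.
by apply/fset0Pn; eexists; exact: fset11.
Qed.

Section DowkerJoin.
Context (A X : choiceType) (Rel : set (A * X)).
Local Notation J := (relational_join (induced_relation Rel)).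

Lemma dowker_lP s : faces (dowker_l Rel) s <->
  s != fset0 /\ exists x, forall a, a \in s -> Rel (a, x).
Proof.
split=> -[s0 [x sx]]; split=> //; exists x; first by move=> a sa; exact: sx.
by move=> [a y] [/= sa ->]; exact: sx.
Qed.

Lemma dowker_rP t : faces (dowker_r Rel) t <->
  t != fset0 /\ exists a, forall x, x \in t -> Rel (a, x).
Proof.
split=> -[t0 [a ta]]; split=> //; exists a; first by move=> x tx; exact: ta.
by move=> [b x] [/= -> tx]; exact: ta.
Qed.

(** An empty left or right part makes its clauses vacuous, so one criterion covers the three kinds
    of simplices of the join. *)
Lemma dowker_joinP e : faces J e <-> [/\ e != fset0,
  forall a x, inl a \in e -> inr x \in e -> Rel (a, x),
  (exists a, inl a \in e) -> exists x, forall a, inl a \in e -> Rel (a, x) &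
  (exists x, inr x \in e) -> exists a, forall x, inr x \in e -> Rel (a, x)].
Proof.
split=> [Je|[e0 eR el er]].
  split; first exact: faces_neq0 Je.
  - case: Je => [[[s _ <-]|[t _ <-]]|[s [t [st ->]]]] a x; rewrite !inf_simpl//=.
    exact: st.
  - case: Je => [[[s /dowker_lP[_ [x sx]] <-]|[t _ <-]]|[s [t [_ ->]]]] [a].
    + by move=> _; exists x => b; rewrite inl_inlf; exact: sx.
    + by rewrite inf_simpl.
    + have /dowker_lP[_ [x sx]] := set_mem (valP s).
      by move=> _; exists x => b; rewrite !inf_simpl; exact: sx.
  - case: Je => [[[s _ <-]|[t /dowker_rP[_ [a ta]] <-]]|[s [t [_ ->]]]] [x].
    + by rewrite inf_simpl.
    + by move=> _; exists a => y; rewrite inr_inrf; exact: ta.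
    + have /dowker_rP[_ [a ta]] := set_mem (valP t).
      by move=> _; exists a => y; rewrite !inf_simpl; exact: ta.
have [s [t est]] := inf_split e; subst e.
have [s0|/fset0Pn[a sa]] := eqVneq s fset0.
  left; right; exists t; last by apply/fsetP => -[x|y]; rewrite !inf_simpl// s0.
  have t0 : t != fset0.
    apply: contraNN e0 => /eqP t0; apply/eqP/fsetP => -[x|y].
      by rewrite !inf_simpl s0.
    by rewrite !inf_simpl t0.
  apply/dowker_rP; split=> //; have /fset0Pn[y ty] := t0.
  have [|a ta] := er; first by exists y; rewrite !inf_simpl.
  by exists a => x tx; apply: ta; rewrite !inf_simpl.
have Ks : faces (dowker_l Rel) s.
  apply/dowker_lP; split; first by apply/fset0Pn; exists a.
  have [|x sx] := el; first by exists a; rewrite !inf_simpl.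
  by exists x => b sb; apply: sx; rewrite !inf_simpl.
have [t0|/fset0Pn[y ty]] := eqVneq t fset0.
  left; left; exists s => //; apply/fsetP => -[x|y]; rewrite !inf_simpl//.
  by rewrite t0.
have Mt : faces (dowker_r Rel) t.
  apply/dowker_rP; split; first by apply/fset0Pn; exists y.
  have [|b tb] := er; first by exists y; rewrite !inf_simpl.
  by exists b => x tx; apply: tb; rewrite !inf_simpl.
right; exists (SigSub (mem_set Ks)), (SigSub (mem_set Mt)); split=> //.
by move=> b x /= sb tx; apply: eR; rewrite !inf_simpl.
Qed.

Lemma dowker_l_join_equivalence (R : realType) :
  homotopy_equivalent R (realization R (dowker_l Rel)) (realization R J).
Proof.
pose j (w : A + X) := if w is inl a then Some a else None.
pose c (L : {fset A + X}) :=
  inlf X (pick_fset [set a | forall x, inr x \in L -> Rel (a, x)]).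
have cP L a : inl a \in c L -> forall x, inr x \in L -> Rel (a, x).
  by rewrite inl_inlf => /pick_fsetP.
apply: (@deformation_equivalence _ _ _ _ _ inl j _ _ _ c).
- by [].
- by case.
- move=> s; rewrite dowker_lP dowker_joinP; split=> [[/fset0Pn[a sa] [x sx]]|].
    split.
    + by apply/fset0Pn; exists (inl a); rewrite inl_inlf.
    + by move=> b y _; rewrite inr_inlf.
    + by move=> _; exists x => b; rewrite inl_inlf; exact: sx.
    + by move=> [y]; rewrite inr_inlf.
  move=> [/fset0Pn[[a|x]]]; rewrite ?inr_inlf// inl_inlf => sa _ sl _.
  split; first by apply/fset0Pn; exists a.
  have [|x sx] := sl; first by exists a; rewrite inl_inlf.
  by exists x => b sb; apply: sx; rewrite inl_inlf.
- by move=> L [a|x]//; rewrite inr_inlf.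
- move=> L /dowker_joinP[L0 _ _ Lr] Lright.
  have /fset0Pn[[a|x] xL] := L0; first by have := Lright _ xL.
  have [|a La] := Lr; first by exists x.
  have /fset0Pn[b bL] : pick_fset [set a | forall x, inr x \in L -> Rel (a, x)] != fset0.
    by apply: pick_fset_neq0; exists a.
  by apply/fset0Pn; exists (inl b); rewrite inl_inlf.
(* Right vertices of [e] lie in [r]. A left vertex of [e] is related to all of [r], either inside
   the simplex [u] or as the vertex chosen for some [L] containing [r]. So [x0] witnesses the left
   part, and the witness for [u] the right part. *)
move=> u r e /dowker_joinP[_ uR _ ur] /fset0Pn[x0 x0r] rP e0 eP.
have er x : inr x \in e -> inr x \in r.
  by move=> /eP[[]|//|[L _]]//; rewrite inr_inlf.
have el a x : inl a \in e -> inr x \in r -> Rel (a, x).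
  move=> /eP[[_ au]|/rP[]//|[L /fsubsetP rL aL]] xr.
    by apply: uR au _; have [] := rP _ xr.
  by apply: cP aL _ _; exact: rL.
apply/dowker_joinP; split=> //.
- by move=> a x ae /er; exact: el.
- case: x0 x0r => [a /rP[]//|x xr] _; exists x => a ae; exact: el.
- move=> [x /er /rP[_ xu]]; have [|a ua] := ur; first by exists x.
  by exists a => y /er /rP[_ yu]; exact: ua.
Qed.

(** The roles of the two sides are exchanged: the [A]-vertices are emptied, and [c L] picks an [x]
    related to every [A]-vertex of [L]. *)
Lemma dowker_r_join_equivalence (R : realType) :
  homotopy_equivalent R (realization R (dowker_r Rel)) (realization R J).
Proof.
pose j (w : A + X) := if w is inr x then Some x else None.
pose c (L : {fset A + X}) :=
  inrf A (pick_fset [set x | forall a, inl a \in L -> Rel (a, x)]).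
have cP L x : inr x \in c L -> forall a, inl a \in L -> Rel (a, x).
  by rewrite inr_inrf => /pick_fsetP.
apply: (@deformation_equivalence _ _ _ _ _ inr j _ _ _ c).
- by [].
- by case.
- move=> s; rewrite dowker_rP dowker_joinP; split=> [[/fset0Pn[x sx] [a sa]]|].
    split.
    + by apply/fset0Pn; exists (inr x); rewrite inr_inrf.
    + by move=> b y; rewrite inl_inrf.
    + by move=> [b]; rewrite inl_inrf.
    + by move=> _; exists a => y; rewrite inr_inrf; exact: sa.
  move=> [/fset0Pn[[a|x]]]; rewrite ?inl_inrf// inr_inrf => sx _ _ sr.
  split; first by apply/fset0Pn; exists x.
  have [|a sa] := sr; first by exists x; rewrite inr_inrf.
  by exists a => y sy; apply: sa; rewrite inr_inrf.
- by move=> L [a|x]//; rewrite inl_inrf.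
- move=> L /dowker_joinP[L0 _ Ll _] Lleft.
  have /fset0Pn[[a|x] aL] := L0; last by have := Lleft _ aL.
  have [|x Lx] := Ll; first by exists a.
  have /fset0Pn[y yL] : pick_fset [set x | forall a, inl a \in L -> Rel (a, x)] != fset0.
    by apply: pick_fset_neq0; exists x.
  by apply/fset0Pn; exists (inr y); rewrite inr_inrf.
move=> u r e /dowker_joinP[_ uR ul _] /fset0Pn[x0 x0r] rP e0 eP.
have el a : inl a \in e -> inl a \in r.
  by move=> /eP[[]|//|[L _]]//; rewrite inl_inrf.
have er a x : inr x \in e -> inl a \in r -> Rel (a, x).
  move=> /eP[[_ xu]|/rP[]//|[L /fsubsetP rL xL]] ar.
    by apply: uR xu; have [] := rP _ ar.
  by apply: cP xL _ _; exact: rL.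
apply/dowker_joinP; split=> //.
- by move=> a x /el ae xe; exact: er.
- move=> [a /el /rP[_ au]]; have [|x ux] := ul; first by exists a.
  by exists x => b /el /rP[_ bu]; exact: ux.
- case: x0 x0r => [a ar|x /rP[]//] _; exists a => x xe; exact: er.
Qed.

End DowkerJoin.

Theorem theorem3p16 (R : realType) (A X : choiceType) (Rel : set (A * X)) :
  homotopy_equivalent R
    (realization R (dowker_l Rel))
    (realization R (relational_join (induced_relation Rel))) /\
  homotopy_equivalent R
    (realization R (relational_join (induced_relation Rel)))
    (realization R (dowker_r Rel)).
Proof.
split; first exact: dowker_l_join_equivalence.
by apply: homotopy_equivalent_sym; exact: dowker_r_join_equivalence.
Qed.
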